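(* The following identities hold (as formal power series in $t$ with coefficients polynomials in $x$): $$\sum_{n=0}^{\infty}K_n(x)\frac{t^n}{n!}=\frac{1}{(1-t)^2}e^{\frac{xt}{(1-t)^2}},\qquad \sum_{n=0}^{\infty}J_n(x)\frac{t^n}{n!}=\frac{1}{1-t}e^{\frac{xt}{(1-t)^2}},\qquad \sum_{n=0}^{\infty}L_n(x)\frac{t^n}{n!}=e^{\frac{xt}{(1-t)^2}}.$$
   Context: $x$ is an indeterminate over the real numbers. For $n\ge 0$, $K_n(x)=n!\sum_{k=0}^{n}\binom{n+k+1}{n-k}\frac{x^k}{k!}$. The polynomials $J_n(x)$ are defined by $J_0(x)=1$ and $J_n(x)=K_n(x)-nK_{n-1}(x)$ for $n\ge 1$. The polynomials $L_n(x)$ are defined by $L_n(x)=J_n(x)-nJ_{n-1}(x)$ for $n\ge 0$, where for $n=0$ the second term is read as $0$, so $L_0(x)=1$. *)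

(* Defs.v *)
From HB Require Import structures.
From mathcomp Require Import all_boot all_order all_algebra.
From mathcomp Require Import boolp.

Set Implicit Arguments.
Unset Strict Implicit.
Unset Printing Implicit Defensive.

Import GRing.Theory.
Local Open Scope ring_scope.

(** * Formal power series in one indeterminate t over a commutative ring

    The record wrapper separates [fps A], with the Cauchy product, from the
    function space [nat -> A], with the pointwise product. *)

Record fps (A : Type) := FPS { fps_coef : nat -> A }.

Lemma fpsP (A : Type) (f g : fps A) : fps_coef f =1 fps_coef g <-> f = g.
Proof. by split=> [|-> //]; case: f g => [f] [g] /= /funext ->. Qed.

HB.instance Definition _ (A : Type) := gen_eqMixin (fps A).
HB.instance Definition _ (A : Type) := gen_choiceMixin (fps A).

Section FpsRing.
Variable A : comNzRingType.
Implicit Types f g h : fps A.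

Definition fps_zero : fps A := FPS (fun=> 0).
Definition fps_opp f := FPS (fun n => - fps_coef f n).
Definition fps_add f g := FPS (fun n => fps_coef f n + fps_coef g n).
Definition fps_const (a : A) : fps A := FPS (fun n => if n == 0%N then a else 0).
Definition fps_mul f g :=
  FPS (fun n => \sum_(i < n.+1) fps_coef f i * fps_coef g (n - i)).

Fact fps_addA : associative fps_add.
Proof. by move=> f g h; apply/fpsP => n /=; rewrite addrA. Qed.

Fact fps_addC : commutative fps_add.
Proof. by move=> f g; apply/fpsP => n /=; rewrite addrC. Qed.

Fact fps_add0 : left_id fps_zero fps_add.
Proof. by move=> f; apply/fpsP => n /=; rewrite add0r. Qed.

Fact fps_addN : left_inverse fps_zero fps_opp fps_add.
Proof. by move=> f; apply/fpsP => n /=; rewrite addNr. Qed.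

HB.instance Definition _ :=
  GRing.isZmodule.Build (fps A) fps_addA fps_addC fps_add0 fps_addN.

Definition fps_trunc N f : {poly A} := \poly_(i < N) fps_coef f i.

Fact fps_coef_trunc_mul N f g n : (n < N)%N ->
  fps_coef (fps_mul f g) n = (fps_trunc N f * fps_trunc N g)`_n.
Proof.
move=> ltnN; rewrite coefM /=; apply: eq_bigr => i _.
by rewrite !coef_poly !(leq_ltn_trans _ ltnN) ?leq_subr // -ltnS.
Qed.

Fact fps_mulA : associative fps_mul.
Proof.
move=> f g h; apply/fpsP => n.
transitivity (fps_trunc n.+1 f * fps_trunc n.+1 g * fps_trunc n.+1 h)`_n.
  rewrite -mulrA coefM; apply: eq_bigr => i _.
  by rewrite -fps_coef_trunc_mul ?ltnS ?leq_subr // coef_poly ltn_ord.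
rewrite coefM; apply: eq_bigr => i _.
by rewrite -fps_coef_trunc_mul // coef_poly ltnS leq_subr.
Qed.

Fact fps_mulC : commutative fps_mul.
Proof.
move=> f g; apply/fpsP => n.
by rewrite !(@fps_coef_trunc_mul n.+1) // mulrC.
Qed.

Fact fps_mul1 : left_id (fps_const 1) fps_mul.
Proof.
move=> f; apply/fpsP => n /=; rewrite big_ord_recl /= mul1r subn0.
by rewrite big1 ?addr0 // => i _; rewrite mul0r.
Qed.

Fact fps_mulDl : left_distributive fps_mul fps_add.
Proof.
move=> f g h; apply/fpsP => n /=; rewrite -big_split /=.
by apply: eq_bigr => i _; rewrite mulrDl.
Qed.

Fact fps_oner_neq0 : fps_const 1 != 0.
Proof. by apply/eqP => /fpsP /(_ 0%N) /= /eqP; rewrite oner_eq0. Qed.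

HB.instance Definition _ := GRing.Zmodule_isComNzRing.Build (fps A)
  fps_mulA fps_mulC fps_mul1 fps_mulDl fps_oner_neq0.

Lemma fps_coefM f g n : fps_coef (f * g) n =
  \sum_(i < n.+1) fps_coef f i * fps_coef g (n - i).
Proof. by []. Qed.

(* Invertibility is taken literally: f is a unit when some g satisfies
   g * f = 1, and f^-1 is then that (unique) g. *)
Definition fps_unit : pred (fps A) := fun f => `[< exists g, g * f = 1 >].

Definition fps_inv f : fps A :=
  if pselect (exists g, g * f = 1) is left fU then projT1 (cid fU) else f.

Fact fps_mulV : {in fps_unit, left_inverse 1 fps_inv *%R}.
Proof.
move=> f /asboolP fU; rewrite /fps_inv.
by case: pselect => // {}fU; case: (cid fU).
Qed.

Fact fps_unitP f g : g * f = 1 -> fps_unit f.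
Proof. by move=> gf1; apply/asboolP; exists g. Qed.

Fact fps_inv_out : {in [predC fps_unit], fps_inv =1 id}.
Proof.
move=> f /negP fNU; rewrite /fps_inv.
by case: pselect => // fU; case: fNU; apply/asboolP.
Qed.

HB.instance Definition _ := GRing.ComNzRing_hasMulInverse.Build (fps A)
  fps_mulV fps_unitP fps_inv_out.

(* The indeterminate t. *)
Definition fps_t : fps A := FPS (fun n => (n == 1%N)%:R).

Lemma fps_coef_exp_small f : fps_coef f 0%N = 0 ->
  forall k n, (n < k)%N -> fps_coef (f ^+ k) n = 0.
Proof.
move=> f0; elim=> // k IHk n; rewrite ltnS => lenk.
rewrite exprS fps_coefM big_ord_recl f0 mul0r add0r big1 // => i _.
have lt0n : (0 < n)%N by apply: leq_ltn_trans (ltn_ord i).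
by rewrite IHk ?mulr0 // (leq_trans _ lenk) // ltn_subrL lt0n.
Qed.

End FpsRing.

Section FpsExp.
Variables (R : numFieldType) (A : comAlgType R).

(* sum_n a_n t^n / n! *)
Definition fps_egf (a : nat -> A) : fps A :=
  FPS (fun n => (n`!%:R^-1 : R) *: a n).

(* exp f = sum_k f^k / k!, meaningful when f has zero constant coefficient:
   the coefficient of t^n then only involves k <= n, see [fps_expE]. *)
Definition fps_exp (f : fps A) : fps A :=
  FPS (fun n => \sum_(k < n.+1) (k`!%:R^-1 : R) *: fps_coef (f ^+ k) n).

Lemma fps_expE (f : fps A) n N : fps_coef f 0%N = 0 -> (n < N)%N ->
  fps_coef (fps_exp f) n =
  \sum_(k < N) (k`!%:R^-1 : R) *: fps_coef (f ^+ k) n.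
Proof.
move=> f0 ltnN; rewrite /fps_exp /=.
rewrite (big_ord_widen N (fun k => (k`!%:R^-1 : R) *: fps_coef (f ^+ k) n)) //.
rewrite big_mkcond; apply: eq_bigr => k _; case: ifPn => //.
by rewrite -leqNgt => ltnk; rewrite fps_coef_exp_small ?scaler0.
Qed.

End FpsExp.

(** * The polynomials K_n, J_n, L_n *)

Section KJL.
Variable R : numFieldType.

Definition K (n : nat) : {poly R} :=
  n`!%:R *: \sum_(0 <= k < n.+1) ('C(n + k + 1, n - k)%:R / k`!%:R) *: 'X^k.

Definition J (n : nat) : {poly R} :=
  if n is m.+1 then K n - n%:R *: K m else 1.

Definition L (n : nat) : {poly R} :=
  if n is m.+1 then J n - n%:R *: J m else J 0%N.

End KJL.

(* Main.v *)
Require Import Defs.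
From mathcomp Require Import all_boot all_order all_algebra.
From mathcomp Require Import reals.
Import GRing.Theory.
Local Open Scope ring_scope.

(** Write [u] for the inverse of [1 - t].  Pascal's rule says that multiplying
    [\sum_n C(n + m, m) t^n] by [1 - t] lowers [m] by one, so this series is
    [u ^+ m.+1] ([fps_inv_1subtX]).  Expanding the exponential,
    [u^2 * exp (x t u^2)] is the sum over [k] of
    [x^k / k! * (t^k * u^(2k + 2))], and the coefficient of [t^n] in
    [t^k * u^(2k + 2)] is [C((n - k) + (2k + 1), 2k + 1)], which is
    [C(n + k + 1, n - k)] by symmetry: this is the first identity ([egf_K]).
    The passages from [K] to [J] and from [J] to [L] both replace [a n] by
    [a n - n a (n - 1)], which multiplies the exponential generating function
    by [1 - t] ([egf_sub_shift]); each of them cancels one factor [u]. *)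

Section Coefficients.
Variable A : comNzRingType.
Implicit Types (f g : fps A) (a : A).
Local Notation t := (fps_t A).

Lemma fps_coef_const_mul a f n :
  fps_coef (fps_const a * f) n = a * fps_coef f n.
Proof.
by rewrite fps_coefM big_ord_recl subn0 big1 ?addr0 // => i _; rewrite mul0r.
Qed.

Lemma fps_constX a k : fps_const a ^+ k = fps_const (a ^+ k).
Proof.
elim: k => [|k IHk]; first by rewrite !expr0.
rewrite !exprS IHk; apply/fpsP => n; rewrite fps_coef_const_mul /=.
by case: (n == 0%N); rewrite ?mulr0.
Qed.

Lemma fps_coef_t_mul f n :
  fps_coef (t * f) n = if n is m.+1 then fps_coef f m else 0.
Proof.
rewrite fps_coefM big_ord_recl mul0r add0r; case: n => [|n].
  by rewrite big_ord0.
rewrite big_ord_recl /= mul1r subSS subn0.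
by rewrite big1 ?addr0 // => i _; rewrite mul0r.
Qed.

Lemma fps_coef_1subt_mul f n :
  fps_coef ((1 - t) * f) n =
  fps_coef f n - (if n is m.+1 then fps_coef f m else 0).
Proof. by rewrite mulrBl mul1r -fps_coef_t_mul. Qed.

Lemma fps_coef_tX_mul k f n : (k <= n)%N ->
  fps_coef (t ^+ k * f) n = fps_coef f (n - k).
Proof.
elim: k n => [|k IHk] n; first by rewrite expr0 mul1r subn0.
by case: n => // n lekn; rewrite exprS -mulrA fps_coef_t_mul IHk.
Qed.

Definition fps_bin m : fps A := FPS (fun n => 'C(n + m, m)%:R).

(** Pascal's rule gives [(1 - t) * fps_bin m.+1 = fps_bin m]; it is iterated down
    to the geometric series [fps_bin 0]. *)
Lemma fps_1subtX_mul_bin m : (1 - t) ^+ m.+1 * fps_bin m = 1.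
Proof.
elim: m => [|m IHm].
  apply/fpsP => -[|n]; rewrite expr1 fps_coef_1subt_mul /= !bin0 ?subr0 //.
  by rewrite subrr.
rewrite exprSr -mulrA -[RHS]IHm; congr (_ * _); apply/fpsP => -[|n].
  by rewrite fps_coef_1subt_mul /= !add0n !binn subr0.
rewrite fps_coef_1subt_mul /= addSn binS natrD -addSnnS.
by rewrite addrAC subrr add0r.
Qed.

Lemma unit_1subt : 1 - t \is a GRing.unit.
Proof.
apply/unitrP; exists (fps_bin 0); rewrite mulrC.
by have := fps_1subtX_mul_bin 0; rewrite expr1.
Qed.

Lemma fps_inv_1subtX m : (1 - t) ^- m.+1 = fps_bin m.
Proof.
rewrite -[RHS](mulKr (unitrX m.+1 unit_1subt)).
by rewrite fps_1subtX_mul_bin mulr1.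
Qed.

End Coefficients.

Section GeneratingFunctions.
Variables (R : numFieldType) (A : comAlgType R).
Local Notation t := (fps_t A).

(** Since [f] has no constant term, [f ^+ k] does not contribute below [t^k], so
    [g * fps_exp f] may be expanded termwise in [k], up to the order [n]. *)
Lemma fps_coef_mul_exp (g f : fps A) n : fps_coef f 0%N = 0 ->
  fps_coef (g * fps_exp f) n =
  \sum_(k < n.+1) (k`!%:R^-1 : R) *: fps_coef (g * f ^+ k) n.
Proof.
move=> f0; rewrite fps_coefM.
(* All the exponential coefficients involved are truncated at the same order,
   so that the two finite sums can be exchanged. *)
under eq_bigr => i _.
  rewrite (@fps_expE _ _ f (n - i) n.+1) ?ltnS ?leq_subr // mulr_sumr.
  over.
rewrite exchange_big; apply: eq_bigr => k _.
by rewrite fps_coefM scaler_sumr; apply: eq_bigr => i _; rewrite scalerAr.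
Qed.

(** As [n.+1 / n.+1`! = 1 / n`!], the term subtracted from [a n.+1] is the
    coefficient of [t^(n + 1)] in [t * fps_egf a]. *)
Lemma egf_sub_shift (a b : nat -> A) : b 0%N = a 0%N ->
  (forall n, b n.+1 = a n.+1 - (n.+1%:R : R) *: a n) ->
  fps_egf b = (1 - t) * fps_egf a.
Proof.
move=> b0 bS; apply/fpsP => -[|n]; rewrite fps_coef_1subt_mul /=.
  by rewrite b0 subr0.
rewrite bS scalerBr scalerA factS natrM invfM mulrAC mulVf ?mul1r //.
by rewrite Num.Theory.pnatr_eq0.
Qed.

End GeneratingFunctions.

Section PolynomialFamilies.
Variable R : numFieldType.
Local Notation t := (fps_t {poly R}).
Local Notation x := (fps_const ('X : {poly R})).

Lemma egf_K :
  fps_egf (K R) = (1 - t) ^- 2 * fps_exp (x * t / (1 - t) ^+ 2).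
Proof.
apply/fpsP => n; rewrite fps_coef_mul_exp; last first.
  by rewrite -mulrA fps_coef_const_mul fps_coef_t_mul mulr0.
rewrite [LHS]/= /K scalerA mulVf ?Num.Theory.pnatr_eq0 -?lt0n ?fact_gt0 //.
rewrite scale1r big_mkord; apply: eq_bigr => k _.
have lekn : (k <= n)%N by rewrite -ltnS.
(* Collecting powers isolates [x^k], the shift [t^k], and [(1 - t) ^- (2 k + 2)]. *)
have -> : (1 - t) ^- 2 * (x * t / (1 - t) ^+ 2) ^+ k =
          fps_const ('X^k) * (t ^+ k * fps_bin {poly R} (k.*2.+1)).
  rewrite -fps_inv_1subtX -fps_constX !exprMn mulrCA -mulrA; congr (_ * (_ * _)).
  by rewrite exprVn -exprM -invrM ?unitrX ?unit_1subt // -exprD mul2n addn2.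
rewrite fps_coef_const_mul fps_coef_tX_mul //=.
have -> : (n - k + k.*2.+1 = n + k + 1)%N.
  by rewrite -addnn addnS addnA subnK // addn1.
have -> : 'C(n + k + 1, k.*2.+1) = 'C(n + k + 1, n - k).
  rewrite -bin_sub; first by congr 'C(_, _); rewrite -addnn addn1 subSS subnDr.
  by rewrite -addnn addn1 ltnS leq_add2r.
by rewrite mulr_natr -scaler_nat scalerA mulrC.
Qed.

Lemma egf_J : fps_egf (J R) = (1 - t) * fps_egf (K R).
Proof.
apply: egf_sub_shift => //.
by rewrite /K big_nat1 bin0 divr1 !scale1r.
Qed.

Lemma egf_L : fps_egf (L R) = (1 - t) * fps_egf (J R).
Proof. exact: egf_sub_shift. Qed.

End PolynomialFamilies.

Theorem mainTheorem10 (R : realType) :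
  let t : fps {poly R} := fps_t {poly R} in
  let x : fps {poly R} := fps_const 'X in
  [/\ fps_egf (K R) = 1 / (1 - t) ^+ 2 * fps_exp (x * t / (1 - t) ^+ 2),
      fps_egf (J R) = 1 / (1 - t) * fps_exp (x * t / (1 - t) ^+ 2)
    & fps_egf (L R) = fps_exp (x * t / (1 - t) ^+ 2)].
Proof.
move=> t x.
have egfK := egf_K R; rewrite -/t -/x in egfK.
have egfJ : fps_egf (J R) = (1 - t)^-1 * fps_exp (x * t / (1 - t) ^+ 2).
  rewrite egf_J egfK mulrA; congr (_ * _).
  by rewrite expr2 invrM ?unit_1subt // mulVKr ?unit_1subt.
split; rewrite ?mul1r //.
by rewrite egf_L egfJ mulVKr ?unit_1subt.
Qed.
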